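(* Let $(X_1,* )$ and $(X_2,\circ)$ be racks with averaging operators $B_1:X_1\to X_1$ and $B_2:X_2\to X_2$, respectively. Let $X=X_1\underset{\sigma,\tau}{\sqcup}X_2$ be the union of the racks $X_1$ and $X_2$ with respect to some $\sigma,\tau$. Let $B:X\to X$ be the map $$B(z):=\begin{cases}B_1(z), & z\in X_1;\\ B_2(z), & z\in X_2.\end{cases}$$ Then $B$ is an averaging operator on $X$ if and only if for any $z_1\in X_1$ and $z_2\in X_2$ the following hold: $$\tau_{B_2(z_2)}(B_1(z_1))=B_1\big(\tau_{B_2(z_2)}(z_1)\big),\qquad \sigma_{B_1(z_1)}(B_2(z_2))=B_2\big(\sigma_{B_1(z_1)}(z_2)\big).$$
   Context: A rack is a non-empty set $Q$ with a binary operation $*$ such that (Q2) for all $x,y\in Q$ there is a unique $z\in Q$ with $x=z*y$, and (Q3) $(x*y)*z=(x*z)*(y*z)$ for all $x,y,z\in Q$. An averaging operator (meaning: right averaging operator) on a rack $(X,\star)$ is a map $B:X\to X$ such that $B(x)\star B(y)=B(x\star B(y))$ for all $x,y\in X$. For a group $G$, $\operatorname{Conj}_{-1}(G)$ is the quandle on the set $G$ with operation $a*_{-1}b=bab^{-1}$; automorphisms here act on the left and are composed as functions. Union of racks: let $\sigma:X_1\to\operatorname{Conj}_{-1}(\operatorname{Aut}(X_2))$ and $\tau:X_2\to\operatorname{Conj}_{-1}(\operatorname{Aut}(X_1))$ be rack homomorphisms; write $\sigma_y(x)=\sigma(y)(x)$ and $\tau_y(x)=\tau(y)(x)$. Define on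 the disjoint union $X_1\sqcup X_2$ the operation: $x\star y=x*y$ if $x,y\in X_1$; $x\star y=x\circ y$ if $x,y\in X_2$; $x\star y=\tau_y(x)$ if $x\in X_1,y\in X_2$; $x\star y=\sigma_y(x)$ if $x\in X_2,y\in X_1$. This is a rack if and only if (i) $\tau(z)(x)*y=\tau(\sigma(y)(z))(x*y)$ for all $x,y\in X_1$, $z\in X_2$, and (ii) $\sigma(z)(x)\circ y=\sigma(\tau(y)(z))(x\circ y)$ for all $x,y\in X_2$, $z\in X_1$. When these conditions hold, the rack $(X_1\sqcup X_2,\star)$ is denoted $X_1\underset{\sigma,\tau}{\sqcup}X_2$ and called the union of racks $X_1$ and $X_2$ with respect to $\sigma,\tau$. *)

(* Defs.v *)
From HB Require Import structures.
From mathcomp Require Import all_boot.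
From mathcomp Require Import boolp.

Set Implicit Arguments.
Unset Strict Implicit.
Unset Printing Implicit Defensive.

Declare Scope rack_scope.
Delimit Scope rack_scope with rack.
Local Open Scope rack_scope.

HB.mixin Record isRack X := {
  rack_op : X -> X -> X;
  rack_nonempty : inhabited X;
  rack_op_solve : forall x y : X, exists! z : X, x = rack_op z y;
  rack_opD : forall x y z : X,
    rack_op (rack_op x y) z = rack_op (rack_op x z) (rack_op y z)
}.

#[short(type="rackType")]
HB.structure Definition Rack := {X of isRack X}.

Notation "x '<*' y" := (rack_op x y)
  (at level 40, left associativity, format "x  '<*'  y") : rack_scope.

Definition rack_morphism (X Y : rackType) (f : X -> Y) : Prop :=
  forall x y : X, f (x <* y) = f x <* f y.

HB.mixin Record isRackHom (X Y : rackType) (f : X -> Y) := {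
  rack_homP : rack_morphism f
}.

HB.structure Definition RackHom (X Y : rackType) := {f of isRackHom X Y f}.

Notation "{ 'rackhom' X -> Y }" := (RackHom.type X%type Y%type)
  (X at level 98, Y at level 99, format "{ 'rackhom'  X  ->  Y }") : type_scope.

Definition averaging_operator (X : rackType) (B : X -> X) : Prop :=
  forall x y : X, B x <* B y = B (x <* B y).

Record rack_aut (X : rackType) : Type := RackAut {
  aut_fun :> X -> X;
  aut_bij : bijective aut_fun;
  aut_morph : rack_morphism aut_fun
}.

Section AutGroup.
Variable X : rackType.

Lemma rack_aut_eq (f g : rack_aut X) : aut_fun f =1 aut_fun g -> f = g.
Proof.
case: f g => [f fb fm] [g gb gm] /= /funext efg; case: _ / efg gb gm => gb gm.
by congr RackAut; exact: Prop_irrelevance.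
Qed.

Definition aut_one : rack_aut X :=
  @RackAut X id (Bijective (fun=> erefl) (fun=> erefl)) (fun _ _ => erefl).

Lemma aut_mul_morph (f g : rack_aut X) : rack_morphism (f \o g).
Proof. by move=> x y; rewrite /= !aut_morph. Qed.

Definition aut_mul (f g : rack_aut X) : rack_aut X :=
  RackAut (bij_comp (aut_bij f) (aut_bij g)) (@aut_mul_morph f g).

Lemma aut_inv_exists (f : rack_aut X) :
  exists g : X -> X, cancel f g /\ cancel g f.
Proof. by case: (aut_bij f) => g fK gK; exists g. Qed.

Definition aut_inv_fun (f : rack_aut X) : X -> X := sval (cid (aut_inv_exists f)).

Lemma aut_funK (f : rack_aut X) : cancel f (aut_inv_fun f).
Proof. by rewrite /aut_inv_fun; case: cid => g []. Qed.

Lemma aut_inv_funK (f : rack_aut X) : cancel (aut_inv_fun f) f.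
Proof. by rewrite /aut_inv_fun; case: cid => g []. Qed.

Lemma aut_inv_morph (f : rack_aut X) : rack_morphism (aut_inv_fun f).
Proof.
move=> x y; rewrite -{1}(aut_inv_funK f x) -{1}(aut_inv_funK f y).
by rewrite -aut_morph aut_funK.
Qed.

Definition aut_inv (f : rack_aut X) : rack_aut X :=
  RackAut (Bijective (aut_inv_funK f) (@aut_funK f)) (@aut_inv_morph f).

Lemma aut_mulA : associative aut_mul.
Proof. by move=> f g h; apply: rack_aut_eq. Qed.

Lemma aut_mul1 : left_id aut_one aut_mul.
Proof. by move=> f; apply: rack_aut_eq. Qed.

Lemma aut_mulr1 : right_id aut_one aut_mul.
Proof. by move=> f; apply: rack_aut_eq. Qed.

Lemma aut_mulV : left_inverse aut_one aut_inv aut_mul.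
Proof. by move=> f; apply: rack_aut_eq => x; exact: aut_funK. Qed.

Lemma aut_mulrV : right_inverse aut_one aut_inv aut_mul.
Proof. by move=> f; apply: rack_aut_eq => x; exact: aut_inv_funK. Qed.

(* groupType requires a choiceType; this one comes from classical choice. *)
HB.instance Definition _ := gen_eqMixin (rack_aut X).
HB.instance Definition _ := gen_choiceMixin (rack_aut X).
HB.instance Definition _ :=
  isGroup.Build (rack_aut X) aut_mulA aut_mul1 aut_mulr1 aut_mulV aut_mulrV.

End AutGroup.

(* A copy of the carrier of G, so that the rack structure is not attached to G
   itself. *)
Definition Conj_m1 (G : groupType) : Type := G.

Section ConjRack.
Variable G : groupType.
Local Open Scope group_scope.

Definition conj_m1_op (a b : G) : G := b * a * b^-1.

Lemma conj_m1_solve (x y : Conj_m1 G) :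
  exists! z : Conj_m1 G, x = conj_m1_op z y.
Proof.
exists ((y : G)^-1 * (x : G) * (y : G)); split=> [|z ->].
  by rewrite /conj_m1_op !mulgA mulgV mul1g mulgK.
by rewrite /conj_m1_op !mulgA mulVg mul1g mulgVK.
Qed.

Lemma conj_m1_opD (x y z : Conj_m1 G) :
  conj_m1_op (conj_m1_op x y) z
  = conj_m1_op (conj_m1_op x z) (conj_m1_op y z).
Proof. by rewrite /conj_m1_op !invgM invgK !mulgA !mulgVK. Qed.

HB.instance Definition _ :=
  isRack.Build (Conj_m1 G) (inhabits (1 : G)) conj_m1_solve conj_m1_opD.

End ConjRack.

Definition rack_act (X Y : rackType)
    (s : {rackhom X -> Conj_m1 (rack_aut Y)}) (y : X) (x : Y) : Y :=
  aut_fun (s y) x.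

Section Union.
Variables X1 X2 : rackType.
Variable sigma : {rackhom X1 -> Conj_m1 (rack_aut X2)}.
Variable tau : {rackhom X2 -> Conj_m1 (rack_aut X1)}.

Definition union_op (x y : X1 + X2) : X1 + X2 :=
  match x, y with
  | inl x, inl y => inl (x <* y)
  | inr x, inr y => inr (x <* y)
  | inl x, inr y => inl (rack_act tau y x)
  | inr x, inl y => inr (rack_act sigma y x)
  end.

Definition union_compatible : Prop :=
  (forall (x y : X1) (z : X2),
     rack_act tau z x <* y = rack_act tau (rack_act sigma y z) (x <* y)) /\
  (forall (x y : X2) (z : X1),
     rack_act sigma z x <* y = rack_act sigma (rack_act tau y z) (x <* y)).

Lemma union_op_solve (x y : X1 + X2) : exists! z, x = union_op z y.
Proof.
have act_solve (X Y : rackType) (s : {rackhom X -> Conj_m1 (rack_aut Y)}) u v :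
    exists! w, v = rack_act s u w.
  rewrite /rack_act; have [g fK gK] := aut_bij (s u : rack_aut Y).
  by exists (g v); split=> [|w ->]; rewrite ?gK ?fK.
case: x y => [x|x] [y|y].
- have [z [ez uz]] := rack_op_solve x y.
  exists (inl z); split=> [|[w|w]] //=; first by rewrite -ez.
  by case=> /uz ->.
- have [z [ez uz]] := act_solve _ _ tau y x.
  exists (inl z); split=> [|[w|w]] //=; first by rewrite -ez.
  by case=> /uz ->.
- have [z [ez uz]] := act_solve _ _ sigma y x.
  exists (inr z); split=> [|[w|w]] //=; first by rewrite -ez.
  by case=> /uz ->.
- have [z [ez uz]] := rack_op_solve x y.
  exists (inr z); split=> [|[w|w]] //=; first by rewrite -ez.
  by case=> /uz ->.
Qed.

Lemma rack_act_op (X Y : rackType) (s : {rackhom X -> Conj_m1 (rack_aut Y)})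
    (y z : X) (x : Y) :
  rack_act s z (rack_act s y x) = rack_act s (y <* z) (rack_act s z x).
Proof.
rewrite /rack_act rack_homP.
by rewrite -[x in LHS](aut_funK (s z : rack_aut Y)).
Qed.

Lemma union_opD : union_compatible <->
  forall x y z, union_op (union_op x y) z
    = union_op (union_op x z) (union_op y z).
Proof.
split=> [[h1 h2] [x|x] [y|y] [z|z] /=|hD].
- by rewrite rack_opD.
- by congr inl; exact: aut_morph.
- by rewrite h1.
- by rewrite rack_act_op.
- by rewrite rack_act_op.
- by rewrite h2.
- by congr inr; exact: aut_morph.
- by rewrite rack_opD.
split=> x y z.
- by have [] := hD (inl x) (inr z) (inl y).
- by have [] := hD (inr x) (inl z) (inr y).
Qed.

Lemma union_nonempty : inhabited (X1 + X2).
Proof. by have [x] := @rack_nonempty X1; exists; left. Qed.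

(* The carrier of the union; the compatibility proof is a parameter because
   the operation is self-distributive only under it. *)
Definition rack_union (h : union_compatible) : Type := (X1 + X2)%type.

HB.instance Definition _ (h : union_compatible) :=
  isRack.Build (rack_union h) union_nonempty union_op_solve
    (proj1 union_opD h).

Definition union_map (h : union_compatible) (B1 : X1 -> X1) (B2 : X2 -> X2)
    (z : rack_union h) : rack_union h :=
  match z with inl x => inl (B1 x) | inr x => inr (B2 x) end.

End Union.

Arguments union_map {X1 X2 sigma tau} h B1 B2 z.

(* Main.v *)
Require Import Defs.
From mathcomp Require Import all_boot.

(** The averaging identity [B x <* B y = B (x <* B y)] on the union splits by
    the summands of [x] and [y], since the extended map preserves both
    summands. When [x] and [y] lie in the same summand, it is the averaging
    identity of [B1] or of [B2]; in the two mixed cases the union operation is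
    the action of one rack on the other, and the identity becomes one of the
    two commutation conditions. *)

Theorem theorem5p5 (X1 X2 : rackType) (B1 : X1 -> X1) (B2 : X2 -> X2)
  (hB1 : averaging_operator B1) (hB2 : averaging_operator B2)
  (sigma : {rackhom X1 -> Conj_m1 (rack_aut X2)})
  (tau : {rackhom X2 -> Conj_m1 (rack_aut X1)})
  (h : union_compatible sigma tau) :
  averaging_operator (union_map h B1 B2) <->
  (forall (z1 : X1) (z2 : X2),
     rack_act tau (B2 z2) (B1 z1) = B1 (rack_act tau (B2 z2) z1) /\
     rack_act sigma (B1 z1) (B2 z2) = B2 (rack_act sigma (B1 z1) z2)).
Proof.
split=> [avgB z1 z2|commB [x|x] [y|y]].
- by split; [have [] := avgB (inl z1) (inr z2)|have [] := avgB (inr z2) (inl z1)].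
- by congr inl; exact: hB1.
- by congr inl; have [] := commB x y.
- by congr inr; have [] := commB y x.
- by congr inr; exact: hB2.
Qed.
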